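(* Let $r$ be a rational function of degree $N$ with a pole at infinity. Let $\mathfrak H$ be a Hilbert space of $\mathbb C^p$-valued functions analytic in an open set containing $r^{-1}(\Omega(r))$ such that, for every $\alpha\in\Omega(r)$, $R^{(r)}_\alpha$ is a bounded operator from $\mathfrak H$ into itself with trivial kernel in $\mathfrak H$, and let $\mathsf A_r$ be the (possibly unbounded) operator in $\mathfrak H$ such that $R^{(r)}_\alpha=(\mathsf A_r-\alpha I)^{-1}$ for $\alpha\in\Omega(r)$. Assume that $$\mathfrak H\cap(\mathfrak L(r)\otimes\mathbb C^p)=\{0\}.$$ Then $$\mathrm{Dom}\,\mathsf A_r=\{f\in\mathfrak H:\ \text{there exists } h_f\in\mathfrak L(r)\otimes\mathbb C^p \text{ such that } r(z)f(z)+h_f(z)\in\mathfrak H\},$$ and then $$(\mathsf A_rf)(z)=r(z)f(z)+h_f(z).$$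
   Context: $r=P/Q$ with $P,Q$ coprime polynomials, $\deg P=N>\deg Q$. $\mathfrak L(r)$ is the $N$-dimensional linear span of the functions $z\mapsto\frac{r(z)-r(a)}{z-a}$, $a$ a point of analyticity of $r$; $\mathfrak L(r)\otimes\mathbb C^p$ is the space of $\mathbb C^p$-valued functions with all components in $\mathfrak L(r)$. $\Omega(r)$ is the set of $\alpha\in\mathbb C$ for which $r(z)=\alpha$ has $N$ pairwise different roots $w_1,\ldots,w_N$. For $\alpha\in\Omega(r)$ and $f$ analytic in a neighborhood of these roots, $$(R^{(r)}_\alpha f)(z)=\frac{f(z)}{r(z)-\alpha}-\sum_{n=1}^N\frac{f(w_n)}{r'(w_n)(z-w_n)},\quad r(z)\ne\alpha,$$ extended analytically across the removable singularities $w_1,\ldots,w_N$. These operators satisfy the resolvent identity $R^{(r)}_\alpha-R^{(r)}_\beta=(\alpha-\beta)R^{(r)}_\alpha R^{(r)}_\beta$, and this together with the trivial kernels ensures the existence of $\mathsf A_r$ (with $\mathrm{Dom}\,\mathsf A_r=\mathrm{ran}\,R^{(r)}_\alpha$). Functions are identified when they agree outside removable singularities. *)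

(* Defs.v *)
From HB Require Import structures.
From mathcomp Require Import all_boot all_order all_algebra.
From mathcomp Require Import sesquilinear complex.
From mathcomp Require Import all_classical all_reals all_analysis.
Set Implicit Arguments.
Unset Strict Implicit.
Unset Printing Implicit Defensive.
Import Order.TTheory GRing.Theory Num.Theory.
Import numFieldNormedType.Exports.
Local Open Scope classical_set_scope.
Local Open Scope ring_scope.

Definition CC (R : realType) : numClosedFieldType := R[i].

(* Division by zero yields 0, so the functions below carry junk values at poles
   and at removable singularities.  Such functions are only ever compared
   through [agree]: they are identified when they differ at finitely many
   points. *)
Definition agree (T V : Type) (D : set T) (F G : T -> V) : Prop :=
  finite_set [set z | D z /\ F z <> G z].

Section RationalFunction.
Variables (C : numClosedFieldType) (P Q : {poly C}).

Definition rfun (z : C) : C := P.[z] / Q.[z].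

Definition regular_pt (z : C) : Prop := Q.[z] != 0.

Definition fiber (alpha : C) : set C :=
  [set z | regular_pt z /\ rfun z = alpha].

Definition rdegree : nat := (size P).-1.

Definition Omega : set C := [set alpha | (fiber alpha #= `I_rdegree)%card].

Definition in_L (h : C -> C) : Prop :=
  exists s : seq (C * C),
    (forall ca, ca \in s -> regular_pt ca.2) /\
    agree setT h
      (fun z => \sum_(ca <- s) ca.1 * ((rfun z - rfun ca.2) / (z - ca.2))).

Definition in_LC (p : nat) (h : C -> 'cV[C]_p) : Prop :=
  forall i, in_L (fun z => h z i ord0).

(* The sum ranges over the finite set of solutions of r(w) = alpha. *)
Definition Rfun (p : nat) (alpha : C) (f : C -> 'cV[C]_p) (z : C)
    : 'cV[C]_p :=
  (rfun z - alpha)^-1 *: f z -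
  \sum_(w \in fiber alpha) (derive1 (rfun : C^o -> C^o) w * (z - w))^-1 *: f w.

End RationalFunction.

(* Complex differentiability in each component; used with D open. *)
Definition analytic_on (C : numClosedFieldType) (p : nat) (D : set C)
    (f : C -> 'cV[C]_p) : Prop :=
  forall (i : 'I_p) (z : C), D z ->
    derivable ((fun x => f x i ord0) : C^o -> C^o) z 1.

(* The complete norm of H is induced by an inner product. *)
Definition is_hilbert (C : numClosedFieldType) (H : completeNormedModType C)
    (ip : {dot H for (@Num.conj C)}) : Prop :=
  forall x : H, `|x| ^+ 2 = ip x x.

(* [ev] realizes the vectors of H as C^p-valued functions on D; the values of
   [ev f] outside D are irrelevant. *)
Definition is_analytic_function_space (C : numClosedFieldType)
    (H : lmodType C) (p : nat) (D : set C) (ev : H -> C -> 'cV[C]_p) : Prop :=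
  [/\ forall (c : C) (f g : H) (z : C), D z ->
        ev (c *: f + g) z = c *: ev f z + ev g z,
      forall f g : H, (forall z, D z -> ev f z = ev g z) -> f = g
    & forall f : H, analytic_on D (ev f)].

Definition in_space (C : numClosedFieldType) (H : lmodType C) (p : nat)
    (D : set C) (ev : H -> C -> 'cV[C]_p) (F : C -> 'cV[C]_p) : Prop :=
  exists g : H, agree D (ev g) F.

Definition bounded_op (C : numClosedFieldType) (H : normedModType C)
    (T : H -> H) : Prop :=
  exists M : C, forall f, `|T f| <= M * `|f|.

(* A linear operator in H; [op_fun] is irrelevant outside [op_dom]. *)
Record operator (C : numClosedFieldType) (H : lmodType C) := Operator {
  op_dom : set H;
  op_fun : H -> H;
  op_dom0 : op_dom 0;
  op_domP : forall c f g, op_dom f -> op_dom g -> op_dom (c *: f + g);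
  op_linear : forall c f g, op_dom f -> op_dom g ->
    op_fun (c *: f + g) = c *: op_fun f + op_fun g }.

(* T = (A - alpha I)^-1, with T defined on the whole of H. *)
Definition is_inverse_of_shift (C : numClosedFieldType) (H : lmodType C)
    (A : operator H) (alpha : C) (T : H -> H) : Prop :=
  (forall f, op_dom A f -> T (op_fun A f - alpha *: f) = f) /\
  (forall g, op_dom A (T g) /\ op_fun A (T g) - alpha *: T g = g).

(* Main.v *)
Require Import Defs.
From HB Require Import structures.
From mathcomp Require Import all_boot all_order all_algebra.
From mathcomp Require Import sesquilinear complex ring.
From mathcomp Require Import finmap separable.
From mathcomp Require Import all_classical all_reals all_analysis.
Import Order.TTheory GRing.Theory Num.Theory.
Import numFieldNormedType.Exports.
Local Open Scope classical_set_scope.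
Local Open Scope ring_scope.

(** Fix alpha in Omega(r), with fiber w_1, ..., w_N, and let S = P - alpha Q,
so that r - alpha = S / Q and the w_n are the N simple roots of S.  Such an
alpha exists ([Omega_nonempty]): a value of r is bad only when it is taken at
a zero of P'Q - PQ', and this polynomial is nonzero.

Multiplying the formula for R_alpha g by r - alpha gives
  r R_alpha g + h = g + alpha R_alpha g,
  h(z) = \sum_n (g(w_n) / r'(w_n)) (r(z) - r(w_n)) / (z - w_n),
and this h lies in L(r) because r(w_n) = alpha
([Rfun_remainder]).  Every f in Dom A is R_alpha g for g = A f - alpha f, so
the identity reads r f + h = A f.

Conversely let r f + h = k in H with h in L(r), and put g = k - alpha f, so
that g = (S / Q) f + h.  Each component of h is q / Q with deg q < N
([in_L_quotient]).  The factor S kills f at the fiber, hence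
g(w_n) = q(w_n) / Q(w_n); since r'(w_n) = S'(w_n) / Q(w_n), the sum subtracted
in R_alpha g is \sum_n q(w_n) / (S'(w_n) (z - w_n)), which is the
partial-fraction expansion of q / S ([partial_fractions]), while
g / (r - alpha) = f + q / S.  Thus R_alpha g = f ([resolvent_solves]), that is,
f is in Dom A and A f = g + alpha f = k.  This settles the reverse inclusion
and the formula for A f, whichever h is used.

Functions are compared off finite sets only.  Values at the fiber and equality
in H are recovered by continuity: two functions differentiable at a point of
the open set D that agree off a finite set agree at that point
([agree_derivable_eq]). *)

Set Implicit Arguments.
Unset Strict Implicit.

(** * Agreement off finite sets and partial fractions *)

Lemma agreeP (T V : Type) (D : set T) (F G : T -> V) :
  agree D F G <->
  exists2 E, finite_set E & forall z, D z -> ~ E z -> F z = G z.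
Proof.
split=> [FG|[E Efin FG]].
  exists [set z | D z /\ F z <> G z] => // z Dz /= nFG.
  by apply: contrapT => FzGz; apply: nFG.
apply: sub_finite_set Efin => z /= [Dz FzGz].
by apply: contrapT => nEz; apply: FzGz; exact: FG.
Qed.

Section PartialFractions.
Variables (F : fieldType) (S : {poly F}) (s : seq F).
Hypotheses (s_uniq : uniq s) (s_roots : all (root S) s)
  (size_S : size S = (size s).+1).

Let cofactor w := S %/ ('X - w%:P).

Let cofactorE w : w \in s -> S = cofactor w * ('X - w%:P).
Proof. by move=> ws; rewrite divpK// dvdp_XsubCl (allP s_roots). Qed.

Let cofactor_root w w' : w \in s -> w' \in s -> w' != w -> (cofactor w).[w'] = 0.
Proof.
move=> ws w's w'w; have /rootP := allP s_roots _ w's.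
rewrite (cofactorE ws) hornerM hornerXsubC => /eqP.
by rewrite mulf_eq0 subr_eq0 (negPf w'w) orbF => /eqP.
Qed.

Let cofactor_deriv w : w \in s -> (cofactor w).[w] = S^`().[w].
Proof.
move=> ws; rewrite [in RHS](cofactorE ws) derivM derivXsubC.
by rewrite !hornerE subrr mulr0 add0r.
Qed.

Let size_cofactor w : size (cofactor w) = size s.
Proof. by rewrite size_divp ?polyXsubC_eq0// size_XsubC size_S subn1. Qed.

(** As S has as many roots in [s] as its degree allows, its cofactor at w has
one degree too few to vanish on all of [s]; its value at w is S'(w). *)
Lemma deriv_neq0_all_roots w : w \in s -> S^`().[w] != 0.
Proof.
move=> ws; rewrite -cofactor_deriv//; apply/eqP => cw0.
have c0 : cofactor w = 0.
  apply: (@roots_geq_poly_eq0 _ _ s); rewrite ?size_cofactor//.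
  apply/allP => w' w's; apply/rootP.
  by have [->//|w'w] := eqVneq w' w; exact: cofactor_root.
by have := size_S; rewrite (cofactorE ws) c0 mul0r size_poly0.
Qed.

(** Lagrange interpolation: q and the sum of the cofactors S / (X - w) with
weights q(w) / S'(w) have degree less than the number of points of [s] and
coincide there; dividing by S gives the expansion. *)
Lemma partial_fractions (q : {poly F}) z : (size q <= size s)%N -> S.[z] != 0 ->
  q.[z] / S.[z] = \sum_(w <- s) q.[w] / S^`().[w] / (z - w).
Proof.
move=> size_q Sz0.
pose l := \sum_(w <- s) (q.[w] / S^`().[w]) *: cofactor w.
have lw w : w \in s -> l.[w] = q.[w].
  move=> ws; rewrite horner_sum (bigD1_seq w)//= big_seq_cond big1; last first.
    by move=> w' /andP[w's w'w]; rewrite hornerZ cofactor_root ?mulr0// eq_sym.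
  by rewrite addr0 hornerZ cofactor_deriv// divfK// deriv_neq0_all_roots.
have -> : q = l.
  apply/eqP; rewrite -subr_eq0; apply/eqP.
  apply: (@roots_geq_poly_eq0 _ _ s) => //.
    by apply/allP => w ws; apply/rootP; rewrite hornerD hornerN lw// subrr.
  rewrite (leq_trans (size_polyD _ _))// size_polyN geq_max size_q /= /l.
  elim/big_ind: _ => [|u v us vs|w _]; first by rewrite size_poly0.
    by rewrite (leq_trans (size_polyD _ _))// geq_max us vs.
  by rewrite (leq_trans (size_scale_leq _ _))// size_cofactor.
rewrite [in LHS]/l horner_sum mulr_suml; apply: eq_big_seq => w ws.
move: Sz0; rewrite lw// hornerZ [in S.[z]](cofactorE ws) hornerM hornerXsubC.
rewrite mulf_eq0 negb_or => /andP[c0 _]; rewrite -!mulrA; congr (_ * (_ * _)).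
by rewrite invfM mulVKf.
Qed.

End PartialFractions.

(** * Derivatives of rational functions and continuation *)

Lemma is_derive_horner (K : numFieldType) (p : {poly K}) (x : K^o) :
  is_derive x 1 (horner p : K^o -> K^o) p^`().[x].
Proof.
elim/poly_ind: p => [|p c ih].
  rewrite deriv0 horner0 (_ : horner 0 = cst 0); first exact: is_derive_cst.
  by apply/funext => y; rewrite horner0.
rewrite (_ : horner _ = (horner p : K^o -> K^o) * id + cst c); last first.
  by apply/funext => y; rewrite !hornerE.
apply: is_derive_eq; rewrite derivD derivC derivM derivX !hornerE /GRing.scale /=.
ring.
Qed.

Lemma derivable_horner_num (K : numFieldType) (p : {poly K}) (x : K^o) :
  derivable (horner p : K^o -> K^o) x 1.
Proof. by have := is_derive_horner p x; case. Qed.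

Section Quotient.
Variables (K : numFieldType) (p q : {poly K}) (x : K^o).
Hypothesis qx : q.[x] != 0.
Let pf : K^o -> K^o := horner p.
Let qf : K^o -> K^o := horner q.

Lemma derivable_quotient :
  derivable ((fun z => p.[z] / q.[z]) : K^o -> K^o) x 1.
Proof.
apply: (@derivableM K K^o pf (fun z => (qf z)^-1)); first exact: derivable_horner_num.
by apply: (@derivableV K K^o qf) => //; exact: derivable_horner_num.
Qed.

Lemma derive1_quotient :
  derive1 ((fun z => p.[z] / q.[z]) : K^o -> K^o) x =
  (p^`().[x] * q.[x] - p.[x] * q^`().[x]) / q.[x] ^+ 2.
Proof.
have dp := is_derive_horner p x; have dq := is_derive_horner q x.
rewrite derive1E (@deriveM K K^o pf (fun z => (qf z)^-1)); last 2 first.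
- exact: derivable_horner_num.
- by apply: (@derivableV K K^o qf) => //; exact: derivable_horner_num.
rewrite (@deriveV K K^o qf x 1 qx (@derivable_horner_num K q x)).
rewrite (derive_val (is_derive := dp)) (derive_val (is_derive := dq)).
rewrite /pf /qf /GRing.scale /=; field.
exact: qx.
Qed.
End Quotient.

(** Both functions have their value at z as limit along the punctured
neighborhoods of z, and these eventually stay in D and avoid the finite
exceptional set. *)
Lemma agree_derivable_eq (K : numFieldType) (D : set K) (u v : K -> K) (z : K) :
  open (D : set K^o) -> D z ->
  derivable (u : K^o -> K^o) z 1 -> derivable (v : K^o -> K^o) z 1 ->
  agree D u v -> u z = v z.
Proof.
move=> Dopen Dz du dv /agreeP[E Efin uvE].
pose F := (z : K^o)^'.
have cont (w : K^o -> K^o) : derivable w z 1 -> w @ F --> w z.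
  by move=> /derivable1_diffP/differentiable_continuous/continuous_withinNx.
have uv : \forall x \near F, u x = v x.
  have clE : closed (E `\ z : set K^o).
    have acc : accessible_space K^o by exact/hausdorff_accessible/norm_hausdorff.
    by apply: (accessible_finite_set_closed.1 acc); exact: finite_setD.
  have nE : \forall x \near F, ~ (E `\ z) x.
    apply: nbhs_dnbhs; apply: open_nbhs_nbhs; split; last by case=> _ /=; exact.
    exact: closed_openC.
  have nD : \forall x \near F, D x.
    by apply: nbhs_dnbhs; exact: open_nbhs_nbhs.
  have nz : \forall x \near F, x != z by exact: nbhs_dnbhs_neq.
  near=> x; apply: uvE; first by near: x.
  move=> Ex; suff : ~ (E `\ z) x by apply; split=> //; apply/eqP; near: x.
  by near: x.
apply: (@cvg_unique K^o (@norm_hausdorff _ _) (u @ F)); first exact: cont.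
by apply: cvg_trans (cont _ dv); apply: near_eq_cvg; near do apply: esym.
Unshelve. all: by end_near. Qed.

(** * Fibers of a rational function *)

Lemma finite_roots (C : closedFieldType) (p : {poly C}) :
  p != 0 -> finite_set [set z | root p z].
Proof.
move=> p0; have [s ps] := closed_field_poly_normal p.
apply: sub_finite_set (finite_seq s) => z /=; rewrite ps rootZ ?lead_coef_eq0//.
by rewrite root_prod_XsubC.
Qed.


Section Fibers.
Variables (C : numClosedFieldType) (P Q : {poly C}).
Hypotheses (Q_neq0 : Q != 0) (coPQ : coprimep P Q) (degPQ : (size Q < size P)%N).

Definition level (alpha : C) : {poly C} := P - alpha *: Q.

Lemma size_level alpha : size (level alpha) = size P.
Proof.
rewrite /level size_polyDl// size_polyN.
exact: leq_ltn_trans (size_scale_leq _ _) degPQ.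
Qed.

Lemma level_neq0 alpha : level alpha != 0.
Proof. by rewrite -size_poly_gt0 size_level (leq_trans _ degPQ). Qed.

Lemma level_root_regular alpha z : root (level alpha) z -> Q.[z] != 0.
Proof.
move=> Sz; apply/eqP => Qz; have /(coprimep_root coPQ) : root P z.
  by move/rootP: Sz; rewrite hornerD hornerN hornerZ Qz mulr0 subr0 => /rootP.
by rewrite Qz eqxx.
Qed.

Lemma rfun_levelE alpha z : Q.[z] != 0 ->
  rfun P Q z - alpha = (level alpha).[z] / Q.[z].
Proof. by move=> Qz; rewrite /rfun !hornerE mulrBl mulfK. Qed.

(** Coprimality is what makes the zeros of P - alpha Q regular points of r. *)
Lemma fiber_level alpha : fiber P Q alpha = [set z | root (level alpha) z].
Proof.
apply/seteqP; split=> z /=.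
  move=> [Qz] /eqP; rewrite -subr_eq0 rfun_levelE// mulf_eq0 invr_eq0.
  by rewrite (negPf Qz) orbF.
move=> Sz; have Qz := level_root_regular Sz; split=> //.
by apply/eqP; rewrite -subr_eq0 rfun_levelE// (rootP Sz) mul0r.
Qed.

Lemma Omega_fiber alpha : Omega P Q alpha ->
  exists s, [/\ fiber P Q alpha = [set` s], uniq s & size P = (size s).+1].
Proof.
rewrite /Omega /= => cardN.
have /finite_fsetP[A fA] : finite_set (fiber P Q alpha).
  by rewrite fiber_level; apply/finite_roots/level_neq0.
move: cardN; rewrite fA => /card_eq_fsetP sA.
exists (enum_fset A); split; [by []|exact: fset_uniq|].
by rewrite [size (enum_fset A)]sA /rdegree prednK// (leq_ltn_trans _ degPQ).
Qed.

(** The quotient rule gives (P'Q - PQ') / Q^2, in which P(w) = alpha Q(w). *)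
Lemma derive1_rfun alpha w : fiber P Q alpha w ->
  derive1 (rfun P Q : C^o -> C^o) w = (level alpha)^`().[w] / Q.[w].
Proof.
move=> [Qw rw]; rewrite /rfun derive1_quotient//.
have -> : P.[w] = alpha * Q.[w] by rewrite -rw /rfun divfK.
rewrite /level derivB derivZ !hornerE; field.
exact: Qw.
Qed.

(** If P'Q = PQ', then P divides P' by coprimality, although P' is nonzero (in
characteristic 0) and of smaller degree. *)
Lemma wronskian_neq0 : P^`() * Q - P * Q^`() != 0.
Proof.
have P_neq0 : P != 0 by rewrite -size_poly_gt0 (leq_trans _ degPQ).
have szP : (1 < size P)%N by rewrite (leq_ltn_trans _ degPQ)// size_poly_gt0.
apply/negP; rewrite subr_eq0 => /eqP PQ.
have : P %| P^`() by rewrite -(Gauss_dvdpl _ coPQ) PQ dvdp_mulr.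
have P'_neq0 : P^`() != 0.
  apply/eqP => /(congr1 (fun p : {poly C} => p`_(size P).-2)) /eqP.
  rewrite coef0 coef_deriv mulrn_eq0 prednK ?ltn_predRL//=.
  by rewrite -lead_coefE lead_coef_eq0 (negPf P_neq0) orbF -leqn0 leqNgt ltn_predRL szP.
by move/(dvdp_leq P'_neq0); rewrite leqNgt lt_size_deriv.
Qed.

(** A multiple root of P - alpha Q is a zero of P'Q - PQ', so it suffices that
alpha avoid the finitely many values of r at these zeros. *)
Lemma Omega_nonempty : exists alpha, Omega P Q alpha.
Proof.
have [cr crE] := closed_field_poly_normal (P^`() * Q - P * Q^`()).
have crP z : (P^`() * Q - P * Q^`()).[z] = 0 -> z \in cr.
  move=> /rootP; rewrite crE rootZ ?root_prod_XsubC//.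
  by rewrite lead_coef_eq0 wronskian_neq0.
have [alpha alphaN] : exists alpha, alpha \notin [seq rfun P Q z | z <- cr].
  apply: contrapT => /forallNP all_crit.
  (* The field is infinite: its first naturals already outnumber the critical
     values. *)
  pose nats := [seq n%:R : C | n <- iota 0 (size cr).+1].
  have : (size nats <= size [seq rfun P Q z | z <- cr])%N.
    apply: uniq_leq_size => [|z _]; last exact/negPn/negP/all_crit.
    rewrite map_inj_uniq ?iota_uniq// => m n /eqP.
    by rewrite eqr_nat => /eqP.
  by rewrite !size_map size_iota ltnn.
exists alpha; have [s sE] := closed_field_poly_normal (level alpha).
have lc0 : lead_coef (level alpha) != 0 by rewrite lead_coef_eq0 level_neq0.
have s_uniq : uniq s.
  rewrite -separable_prod_XsubC.
  have /eqp_separable <- : level alpha %= \prod_(z <- s) ('X - z%:P).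
    by rewrite sE eqp_scale.
  rewrite separable_poly.unlock; apply: Pdiv.ClosedField.root_coprimep => z Sz.
  apply: contraNN alphaN => /eqP; rewrite /level derivB derivZ => S'z.
  have Qz := level_root_regular Sz.
  have [_ <-] : fiber P Q alpha z by rewrite fiber_level.
  apply: map_f; apply: crP; move/rootP: Sz S'z; rewrite !hornerE.
  move=> /eqP; rewrite subr_eq0 => /eqP -> /eqP; rewrite subr_eq0 => /eqP ->.
  by ring.
rewrite /Omega /=; have -> : fiber P Q alpha = [set` s].
  rewrite fiber_level; apply/seteqP; split=> z /=;
  by rewrite sE rootZ ?root_prod_XsubC.
rewrite (_ : [set` s] = [set` [fset z in s]%fset]); last first.
  by apply/seteqP; split=> z /=; rewrite !inE.
apply/card_eq_fsetP; rewrite card_fseq undup_id// /rdegree -(size_level alpha).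
by rewrite sE size_scale// size_prod_XsubC.
Qed.

End Fibers.

(** * Elements of L(r) and the operator R_alpha *)

Section Quotients.
Variables (C : numClosedFieldType) (P Q : {poly C}).
Hypotheses (Q_neq0 : Q != 0) (coPQ : coprimep P Q) (degPQ : (size Q < size P)%N).

(** With S = P - r(a) Q, the quotient is (S / (X - a)) / Q, and X - a divides
S. *)
Lemma rfun_difference_quotient (a : C) : Q.[a] != 0 ->
  exists2 q : {poly C}, (size q < size P)%N &
    forall z, Q.[z] != 0 -> z != a ->
      (rfun P Q z - rfun P Q a) / (z - a) = q.[z] / Q.[z].
Proof.
move=> Qa; set S := level P Q (rfun P Q a).
have Sa : root S a.
  have := fiber_level coPQ (rfun P Q a); rewrite -/S => /seteqP[+ _].
  by apply; split.
exists (S %/ ('X - a%:P)).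
  rewrite size_divp ?polyXsubC_eq0// size_XsubC subn1 size_level//.
  by rewrite prednK// (leq_trans _ degPQ).
move=> z Qz za; rewrite rfun_levelE// -/S.
have /(congr1 (horner^~ z)) : S = S %/ ('X - a%:P) * ('X - a%:P).
  by rewrite divpK// dvdp_XsubCl.
rewrite hornerM hornerXsubC => ->.
by rewrite mulrAC mulfK// subr_eq0.
Qed.

Lemma in_L_quotient (h : C -> C) : in_L P Q h ->
  exists2 q : {poly C}, (size q < size P)%N &
    agree setT h (fun z => q.[z] / Q.[z]).
Proof.
move=> [s [s_reg /agreeP[E Efin hE]]].
suff [q sq [E' E'fin qE]] : exists2 q : {poly C}, (size q < size P)%N &
    exists2 E', finite_set E' & forall z, ~ E' z ->
    \sum_(ca <- s) ca.1 * ((rfun P Q z - rfun P Q ca.2) / (z - ca.2)) =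
    q.[z] / Q.[z].
  exists q => //; apply/agreeP; exists (E `|` E'); first by rewrite finite_setU.
  by move=> z _ /not_orP[nE nE']; rewrite hE// qE.
elim: s s_reg {hE} => [_|[c a] s IH s_reg].
  exists 0; first by rewrite size_poly0 (leq_trans _ degPQ).
  by exists set0 => // z _; rewrite big_nil horner0 mul0r.
have [|q sq [E' E'fin qE]] := IH.
  by move=> ca cas; apply: s_reg; rewrite inE cas orbT.
have [q' sq' q'E] := rfun_difference_quotient (s_reg (c, a) (mem_head _ _)).
exists (c *: q' + q).
  rewrite (leq_ltn_trans (size_polyD _ _))// gtn_max sq andbT.
  exact: leq_ltn_trans (size_scale_leq _ _) sq'.
exists (E' `|` [set a] `|` [set z | root Q z]).
  by rewrite !finite_setU; split=> //; exact: finite_roots.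
move=> z /not_orP[/not_orP[nE' /eqP za] /negP Qz].
rewrite big_cons qE//= q'E// hornerD hornerZ.
by rewrite mulrDl mulrA.
Qed.

End Quotients.

Section Resolvent.
Variables (C : numClosedFieldType) (P Q : {poly C}) (p : nat).
Hypotheses (Q_neq0 : Q != 0) (coPQ : coprimep P Q) (degPQ : (size Q < size P)%N).
Variable alpha : C.
Hypothesis Omega_alpha : Omega P Q alpha.

(** Multiply the definition of R_alpha f by r - alpha and use r(w) = alpha on
the fiber to recognize an element of L(r). *)
Lemma Rfun_remainder (f : C -> 'cV[C]_p) :
  exists2 h, in_LC P Q h &
    agree setT (fun z => rfun P Q z *: Rfun P Q alpha f z + h z)
      (fun z => f z + alpha *: Rfun P Q alpha f z).
Proof.
have [s [sE s_uniq size_s]] := Omega_fiber coPQ degPQ Omega_alpha.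
pose c w := (derive1 (rfun P Q : C^o -> C^o) w)^-1.
exists (fun z => \sum_(w <- s)
    (c w * ((rfun P Q z - rfun P Q w) / (z - w))) *: f w).
  move=> i; exists [seq (c w * f w i ord0, w) | w <- s]; split=> [ca|].
    move=> /mapP[w ws ->] /=.
    by have [] : fiber P Q alpha w by rewrite sE.
  apply/agreeP; exists set0 => // z _ _; rewrite summxE big_map.
  by apply: eq_bigr => w _; rewrite mxE /= mulrAC.
apply/agreeP; exists ([set z | root Q z] `|` [set` s]).
  by rewrite finite_setU; split=> //; exact: finite_roots.
move=> z _ /not_orP[/negP Qz nsz].
have rz : rfun P Q z - alpha != 0.
  rewrite subr_eq0; apply/eqP => rz; apply: nsz; rewrite -sE; by split.
have rw w : w \in s -> rfun P Q w = alpha.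
  by move=> ws; have [] : fiber P Q alpha w by rewrite sE.
rewrite addrC; apply/eqP; rewrite -subr_eq -addrA -scalerBl; apply/eqP.
rewrite /Rfun sE -fsbig_seq// scalerBr scalerA divff// scale1r.
rewrite addrCA -[RHS]addr0; congr (_ + _); apply/eqP.
rewrite subr_eq0 scaler_sumr; apply/eqP; apply: eq_big_seq => w ws.
rewrite (rw w)// scalerA; congr (_ *: _).
by rewrite invfM mulrCA.
Qed.

(** Where g = (r - alpha) f + q / Q, dividing by r - alpha leaves f + q / S with
S = P - alpha Q, and the sum over the fiber removes exactly the partial
fractions of q / S. *)
Lemma Rfun_level_quotient (f g : C -> 'cV[C]_p) (i : 'I_p) (q : {poly C})
    (z : C) : (size q < size P)%N ->
  (forall w, fiber P Q alpha w -> g w i ord0 = q.[w] / Q.[w]) ->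
  Q.[z] != 0 -> ~ fiber P Q alpha z ->
  g z i ord0 = (rfun P Q z - alpha) * f z i ord0 + q.[z] / Q.[z] ->
  Rfun P Q alpha g z i ord0 = f z i ord0.
Proof.
move=> size_q g_fiber Qz nfz gz.
have [s [sE s_uniq size_s]] := Omega_fiber coPQ degPQ Omega_alpha.
have Sz : (level P Q alpha).[z] != 0.
  by apply/eqP => /rootP Sz; apply: nfz; rewrite fiber_level.
rewrite /Rfun sE -fsbig_seq// !mxE summxE gz rfun_levelE//.
rewrite (eq_big_seq (fun w => q.[w] / (level P Q alpha)^`().[w] / (z - w))).
  rewrite -partial_fractions//; last 3 first.
  - by apply/allP => w ws; have : [set` s] w by []; rewrite -sE fiber_level.
  - by rewrite size_level.
  - by rewrite -ltnS -size_s.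
  by field; rewrite Sz Qz.
move=> w ws; have fw : fiber P Q alpha w by rewrite sE.
have Qw : Q.[w] != 0 by case: fw.
rewrite !mxE g_fiber// (derive1_rfun fw) invfM invf_div.
move: (_^`().[w]^-1) (z - w)^-1 => a b; field.
exact: Qw.
Qed.

End Resolvent.

(** * Solving the resolvent equation in the function space *)

Section FunctionSpace.
Variables (R : realType) (P Q : {poly CC R}) (p : nat).
Hypotheses (coPQ : coprimep P Q) (degPQ : (size Q < size P)%N).
Variables (D : set (CC R)) (H : lmodType (CC R)) (ev : H -> CC R -> 'cV[CC R]_p).
Hypotheses (D_open : open (D : set (CC R)^o))
  (H_functions : is_analytic_function_space D ev).

Lemma agree_analytic_eq (f g : H) : agree D (ev f) (ev g) -> f = g.
Proof.
have [_ ev_inj ev_an] := H_functions.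
move=> /agreeP[E Efin fgE]; apply: ev_inj => z Dz; apply/matrixP => i j.
rewrite (ord1 j); apply: (agree_derivable_eq (u := fun x => ev f x i ord0)
  (v := fun x => ev g x i ord0) D_open Dz).
- exact: ev_an.
- exact: ev_an.
by apply/agreeP; exists E => // x Dx nEx; rewrite fgE.
Qed.

(** Componentwise g = k - alpha f equals (r - alpha) f + q / Q, off a finite set
and, in the limit, as q / Q on the fiber; these are the data under which
[Rfun_level_quotient] recovers f from g, and analytic functions that agree off
a finite set are the same vector of H. *)
Lemma resolvent_solves (alpha : CC R) (T : H -> H) (f k : H) h :
  Q != 0 ->
  Omega P Q alpha -> fiber P Q alpha `<=` D ->
  (forall g, agree D (ev (T g)) (Rfun P Q alpha (ev g))) ->
  in_LC P Q h -> agree D (ev k) (fun z => rfun P Q z *: ev f z + h z) ->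
  T (k - alpha *: f) = f.
Proof.
move=> Q_neq0 Omega_alpha fiberD TE hL /agreeP[E Efin kE].
have [ev_lin _ ev_an] := H_functions.
set g := k - alpha *: f.
have evg z : D z -> ev g z = ev k z - alpha *: ev f z.
  by move=> Dz; rewrite /g addrC -scaleNr ev_lin// scaleNr addrC.
apply: agree_analytic_eq.
have comp (i : 'I_p) : exists2 E, finite_set E & forall z, D z -> ~ E z ->
    ev (T g) z i ord0 = ev f z i ord0.
  have [q size_q /agreeP[E1 E1fin hE]] := in_L_quotient Q_neq0 coPQ degPQ (hL i).
  have [E2 E2fin TgE] := (agreeP _ _ _).1 (TE g).
  pose E3 := E `|` E1 `|` [set z | root Q z].
  have E3fin : finite_set E3.
    by rewrite !finite_setU; split=> //; exact: finite_roots.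
  have gE z : D z -> ~ E3 z ->
      ev g z i ord0 = (rfun P Q z - alpha) * ev f z i ord0 + q.[z] / Q.[z].
    move=> Dz /not_orP[/not_orP[nE nE1] _].
    by rewrite evg// kE// !mxE hE// mulrBl; ring.
  (* [Rfun] reads g on the fiber, where gE is silent; analyticity of g and f at
     w turns gE into its limit, in which the factor r - alpha vanishes. *)
  have g_fiber w : fiber P Q alpha w -> ev g w i ord0 = q.[w] / Q.[w].
    move=> fw; have Dw := fiberD _ fw; have [Qw _] := fw.
    have Sw : (level P Q alpha).[w] = 0.
      by apply/rootP; move: fw; rewrite fiber_level.
    pose S_f := (fun z => (level P Q alpha).[z] / Q.[z] : (CC R)^o) *
      ((fun z => ev f z i ord0) : (CC R)^o -> (CC R)^o).
    have -> : q.[w] / Q.[w] = (S_f + (fun z => q.[z] / Q.[z])) w.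
      by rewrite /S_f !fctE Sw !mul0r add0r.
    apply: (agree_derivable_eq (u := fun x => ev g x i ord0) D_open Dw); first exact: ev_an.
      apply: derivableD; last exact: derivable_quotient.
      by apply: derivableM; [exact: derivable_quotient|exact: ev_an].
    apply/agreeP; exists E3 => // z Dz nE3.
    rewrite gE// rfun_levelE//.
    by move: nE3 => /not_orP[_ /negP].
  exists (E2 `|` E3 `|` fiber P Q alpha).
    rewrite finite_setU fiber_level//; split; last exact/finite_roots/level_neq0.
    by rewrite finite_setU; split.
  move=> z Dz /not_orP[/not_orP[nE2 nE3] nfz].
  rewrite TgE//; apply: (Rfun_level_quotient coPQ degPQ Omega_alpha size_q) => //.
    by move: nE3 => /not_orP[_ /negP].
  exact: gE.
have [E' E'P] := choice (fun i => let: ex_intro2 E a b := comp i in ex_intro _ E (conj a b)).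
apply/agreeP; exists (\bigcup_(i in [set: 'I_p]) E' i).
  apply: bigcup_finite => // i _; exact: (E'P i).1.
move=> z Dz nE; apply/matrixP => i j; rewrite (ord1 j).
by apply: (E'P i).2 => // Ez; apply: nE; exists i.
Qed.
End FunctionSpace.

Theorem theorem7p3 (R : realType) (P Q : {poly CC R}) (p : nat)
  (Q_neq0 : Q != 0) (coPQ : coprimep P Q) (degPQ : (size Q < size P)%N)
  (D : set (CC R)) (D_open : open (D : set (CC R)^o))
  (D_fibers : \bigcup_(alpha in Omega P Q) fiber P Q alpha `<=` D)
  (H : completeNormedModType (CC R))
  (ip : {dot H for (@Num.conj (CC R))}) (H_hilbert : is_hilbert ip)
  (ev : H -> CC R -> 'cV[CC R]_p)
  (H_functions : is_analytic_function_space D ev)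
  (Rop : CC R -> {linear H -> H})
  (RopE : forall alpha, Omega P Q alpha ->
     forall f, agree D (ev (Rop alpha f)) (Rfun P Q alpha (ev f)))
  (Rop_bounded : forall alpha, Omega P Q alpha -> bounded_op (Rop alpha))
  (Rop_ker : forall alpha, Omega P Q alpha ->
     forall f, Rop alpha f = 0 -> f = 0)
  (A : operator H)
  (A_resolvent : forall alpha, Omega P Q alpha ->
     is_inverse_of_shift A alpha (Rop alpha))
  (H_cap_L : [set f : H | exists2 h, in_LC P Q h & agree D (ev f) h]
             = [set 0]) :
  op_dom A = [set f : H | exists2 h : CC R -> 'cV[CC R]_p, in_LC P Q h &
                in_space D ev (fun z => rfun P Q z *: ev f z + h z)] /\
  (forall (f : H) (h : CC R -> 'cV[CC R]_p), op_dom A f -> in_LC P Q h ->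
     in_space D ev (fun z => rfun P Q z *: ev f z + h z) ->
     agree D (ev (op_fun A f)) (fun z => rfun P Q z *: ev f z + h z)).
Proof.
have [alpha Omega_alpha] := Omega_nonempty Q_neq0 coPQ degPQ.
have fiberD : fiber P Q alpha `<=` D.
  by move=> z fz; apply: D_fibers; exists alpha.
have [AT TA] := A_resolvent _ Omega_alpha.
have ev_lin := let: And3 l _ _ := H_functions in l.
(* The resolvent equation at a single alpha determines the graph of A. *)
have dom_graph f h k : in_LC P Q h ->
    agree D (ev k) (fun z => rfun P Q z *: ev f z + h z) ->
    op_dom A f /\ op_fun A f = k.
  move=> hL kE; have [+ +] := TA (k - alpha *: f).
  rewrite (resolvent_solves coPQ degPQ D_open H_functions Q_neq0 Omega_alpha
    fiberD (RopE _ Omega_alpha) hL kE) => domf.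
  by move=> /(congr1 (+%R^~ (alpha *: f))); rewrite !subrK.
split; last first.
  by move=> f h _ hL [k kE]; have [_ ->] := dom_graph _ _ _ hL kE.
apply/seteqP; split=> f /=; last first.
  by move=> [h hL [k kE]]; have [] := dom_graph _ _ _ hL kE.
move=> domf; pose g := op_fun A f - alpha *: f.
have evg z : D z -> ev g z = ev (op_fun A f) z - alpha *: ev f z.
  by move=> Dz; rewrite /g addrC -scaleNr ev_lin// scaleNr addrC.
have [h hL /agreeP[E Efin hE]] := Rfun_remainder Q_neq0 coPQ degPQ Omega_alpha (ev g).
exists h => //; exists (op_fun A f).
have := RopE _ Omega_alpha g; rewrite AT// => /agreeP[E' E'fin fE].
apply/agreeP; exists (E `|` E'); first by rewrite finite_setU.
move=> z Dz /not_orP[nE nE'].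
by rewrite fE// hE// -fE// evg// subrK.
Qed.
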